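(* Let $L:I\times\mathbb{R}^4\to\mathbb{R}$, $L=L(t,u_1,u_2,u_3,u_4)$, satisfy: (H1) for every $t\in I$ the map $(u_1,\dots,u_4)\mapsto L(t,u_1,\dots,u_4)$ is in $C^1(\mathbb{R}^4,\mathbb{R})$; (H2) for every $y\in\mathcal{Y}^1$ the function $t\mapsto L\{y\}(t)$ is continuous at $\omega_0$; (H3) for every $y\in\mathcal{Y}^1$ and every $i\in\{2,3,4,5\}$ the function $t\mapsto\partial_iL\{y\}(t)$ belongs to $\mathcal{Y}^1$. Let $L(t,u_1,\dots,u_4)$ be jointly convex (resp. jointly concave) in $(u_1,\dots,u_4)$. If $\tilde y\in\mathcal{Y}^1$ satisfies $$\partial_2L\{\tilde y\}(t)-D_{q,\omega}\big[\partial_3L\{\tilde y\}\big](t)=0\quad\text{for all }t\in[a,b]_{q,\omega},$$ $$\partial_3L\{\tilde y\}(a)=\int_a^b\partial_4L\{\tilde y\}(t)\,d_{q,\omega}t\qquad\text{and}\qquad\partial_3L\{\tilde y\}(b)=-\int_a^b\partial_5L\{\tilde y\}(t)\,d_{q,\omega}t,$$ then $\tilde y$ is a global minimizer (resp. global maximizer) over $\mathcal{Y}^1$ of $$\mathcal{L}[y]=\int_a^bL\big(t,y(qt+\omega),D_{q,\omega}[y](t),y(a),y(b)\big)\,d_{q,\omega}t .$$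
   Context: Let $q\in\,]0,1[$, $\omega\ge 0$, $\omega_0:=\omega/(1-q)$, let $I\subseteq\mathbb{R}$ be an interval containing $\omega_0$, and let $a,b\in I$ with $a<b$. Hahn difference operator: for $f:I\to\mathbb{R}$ differentiable at $\omega_0$, $D_{q,\omega}[f](t):=\frac{f(qt+\omega)-f(t)}{(q-1)t+\omega}$ if $t\ne\omega_0$, and $D_{q,\omega}[f](\omega_0):=f'(\omega_0)$ (ordinary derivative). $D^0_{q,\omega}[f]=f$ and $D^i_{q,\omega}$ is the $i$-fold iterate. $q,\omega$-integral: with $[k]_q:=\frac{1-q^k}{1-q}$, for $x\in I$, $\int_{\omega_0}^x f(t)\,d_{q,\omega}t:=(x(1-q)-\omega)\sum_{k=0}^{\infty}q^kf(xq^k+\omega[k]_q)$ (said to exist if the series converges), and $\int_a^b f\,d_{q,\omega}t:=\int_{\omega_0}^b f\,d_{q,\omega}t-\int_{\omega_0}^a f\,d_{q,\omega}t$. $[a,b]_{q,\omega}:=\{q^na+\omega[n]_q:n\in\mathbb{N}_0\}\cup\{q^nb+\omega[n]_q:n\in\mathbb{N}_0\}\cup\{\omega_0\}$. For $r\in\{0,1\}$, $\mathcal{Y}^r$ is the set of $y:I\to\mathbb{R}$ such that $D^i_{q,\omega}[y]$, $i=0,\dots,r$, are bounded on $[a,b]$ and continuous at $\omega_0$. $\partial_iL$ is the partial derivative of $L$ with respect to its $i$th argument ($t$ being the first). For $y\in\mathcal{Y}^1$, $\{y\}(t):=(t,y(qt+\omega),D_{q,\omega}[y](t),y(a),y(b))$,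 $L\{y\}(t):=L(\{y\}(t))$, $\partial_iL\{y\}(t):=(\partial_iL)(\{y\}(t))$; $D_{q,\omega}[\partial_3L\{y\}]$ is the Hahn derivative of the function $t\mapsto\partial_3L\{y\}(t)$. A function $f:I\times\mathbb{R}^4\to\mathbb{R}$ is jointly convex (resp. concave) in $(u_1,\dots,u_4)$ if $\partial_if$, $i=2,\dots,5$, are continuous and $$f(t,u_1+\bar u_1,\dots,u_4+\bar u_4)-f(t,u_1,\dots,u_4)\ge(\text{resp. }\le)\ \sum_{i=2}^5\partial_if(t,u_1,\dots,u_4)\,\bar u_{i-1}$$ for all $(t,u_1,\dots,u_4),(t,u_1+\bar u_1,\dots,u_4+\bar u_4)\in I\times\mathbb{R}^4$. $\tilde y$ is a global minimizer (resp. maximizer) if $\mathcal{L}[\tilde y]\le\mathcal{L}[y]$ (resp. $\ge$) for all $y\in\mathcal{Y}^1$.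
   Formalization: Adds the hypothesis that a ≤ ω_0 ≤ b, or a = q^n b + ω[n]_q, or b = q^n a + ω[n]_q for some n; without it the claim fails (e.g. q=1/2, ω=0, a=1, b=3/2, L=c(t)u_1^2 with c a small bump at 1/8). *)

(* Defs.v *)
From HB Require Import structures.
From mathcomp Require Import all_boot all_order all_algebra.
From mathcomp Require Import all_classical all_reals all_analysis.

Set Implicit Arguments.
Unset Strict Implicit.
Unset Printing Implicit Defensive.

Import Order.TTheory GRing.Theory Num.Theory.
Import numFieldNormedType.Exports.

Local Open Scope classical_set_scope.
Local Open Scope ring_scope.

(* A function I -> R is represented by a total function R -> R.  Everything
   below depends only on its values on the interval I: limits are taken along
   I, and q * t + w stays in I for t in I. *)

Section Hahn.
Context {R : realType}.
Implicit Types (I : set R) (q w a b x t : R) (f y : R -> R).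

Definition omega0 q w : R := w / (1 - q).

Definition qnum q (k : nat) : R := (1 - q ^+ k) / (1 - q).

Definition cont_on I f x : Prop := f t @[t --> within I (nbhs x)] --> f x.

(* The ordinary derivative of f : I -> R at x; it is one-sided when x is an
   endpoint of I. *)
Definition derivable_on I f x : Prop :=
  cvg ((f t - f x) / (t - x) @[t --> within I x^']).

Definition derive_on I f x : R :=
  lim ((f t - f x) / (t - x) @[t --> within I x^']).

Definition hahn I q w f : R -> R := fun t =>
  if t == omega0 q w then derive_on I f (omega0 q w)
  else (f (q * t + w) - f t) / ((q - 1) * t + w).

(* The value is arbitrary when the series diverges. *)
Definition qwint0 q w f x : R :=
  (x * (1 - q) - w) *
  limn (series (fun k => q ^+ k * f (x * q ^+ k + w * qnum q k))).

Definition qwint q w a b f : R := qwint0 q w f b - qwint0 q w f a.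

Definition qworbit q w x : set R :=
  [set t | exists n : nat, t = q ^+ n * x + w * qnum q n].

Definition qwinterval q w a b : set R :=
  qworbit q w a `|` qworbit q w b `|` [set omega0 q w].

(* The derivability clause says that the iterated Hahn derivatives up to order
   r are defined at omega0. *)
Definition calY I q w a b (r : nat) : set (R -> R) := [set y |
  (forall i, (i < r)%N -> derivable_on I (iter i (hahn I q w) y) (omega0 q w)) /\
  (forall i, (i <= r)%N ->
     [bounded iter i (hahn I q w) y t | t in `[a, b]] /\
     cont_on I (iter i (hahn I q w) y) (omega0 q w))].

End Hahn.

Section Lagrangian.
Context {R : realType}.
Implicit Types (I : set R) (q w a b t : R) (y : R -> R).
Implicit Types (L : R -> 'rV[R]_4 -> R) (u v : 'rV[R]_4).

(* L(t, u_1, ..., u_4) is L t u, and the entry of u of index j : 'I_4 is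
   u_(j+1), so [partial L j] is the derivative of L with respect to its
   argument number j + 2, t being argument number 1. *)
Definition partial L (j : 'I_4) : R -> 'rV[R]_4 -> R :=
  fun t u => 'D_(delta_mx 0 j) (L t) u.

Definition d2 L := partial L (inord 0).
Definition d3 L := partial L (inord 1).
Definition d4 L := partial L (inord 2).
Definition d5 L := partial L (inord 3).

Definition C1 (g : 'rV[R]_4 -> R) : Prop := forall j : 'I_4,
  (forall u, derivable g u (delta_mx 0 j)) /\
  continuous (fun u => 'D_(delta_mx 0 j) g u).

(* L{y}(t) *)
Definition bracket I q w a b L y : R -> R := fun t =>
  L t (\row_(j < 4) tnth [tuple y (q * t + w); hahn I q w y t; y a; y b] j).

Definition partials_continuous I L : Prop := forall j : 'I_4,
  (forall t u, I t -> derivable (L t) u (delta_mx 0 j)) /\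
  {within I `*` [set: 'rV[R]_4],
    continuous (fun p : R * 'rV[R]_4 => partial L j p.1 p.2)}.

Definition jointly_convex I L : Prop := partials_continuous I L /\
  forall t u v, I t ->
    L t (u + v) - L t u >= \sum_(j < 4) partial L j t u * v 0 j.

Definition jointly_concave I L : Prop := partials_continuous I L /\
  forall t u v, I t ->
    L t (u + v) - L t u <= \sum_(j < 4) partial L j t u * v 0 j.

Definition functional I q w a b L y : R :=
  qwint q w a b (bracket I q w a b L y).

Definition global_minimizer I q w a b L y0 : Prop :=
  forall y, calY I q w a b 1 y ->
    functional I q w a b L y0 <= functional I q w a b L y.

Definition global_maximizer I q w a b L y0 : Prop :=
  forall y, calY I q w a b 1 y ->
    functional I q w a b L y0 >= functional I q w a b L y.

Definition euler_lagrange I q w a b L y : Prop :=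
  forall t, qwinterval q w a b t ->
    bracket I q w a b (d2 L) y t
      - hahn I q w (bracket I q w a b (d3 L) y) t = 0.

Definition boundary_conditions I q w a b L y : Prop :=
  bracket I q w a b (d3 L) y a = qwint q w a b (bracket I q w a b (d4 L) y) /\
  bracket I q w a b (d3 L) y b = - qwint q w a b (bracket I q w a b (d5 L) y).

End Lagrangian.

(* Main.v *)
Require Import Defs.
From mathcomp Require Import all_boot all_order all_algebra.
From mathcomp Require Import all_classical all_reals all_analysis.
From mathcomp Require Import ring.
Import Order.TTheory GRing.Theory Num.Theory.
Import numFieldNormedType.Exports.
Local Open Scope classical_set_scope.
Local Open Scope ring_scope.

(** The argument is the classical one: for a convex Lagrangian a critical point
of the functional is a global minimizer.  Write c for [omega0 q w] and sigma for
the map t |-> q t + w, whose fixed point is c.  Since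
sigma^k x = c + q^k (x - c), the integral from c to x is the series with terms
(1 - q) (x - c) q^k f (sigma^k x), so it only sees the orbit of x, and the point c
never matters: an orbit reaches c only if x = c, and then all terms vanish.

Let h = y - yt.  Convexity at yt bounds the integrand of L[y] - L[yt] from below
by its linear part
  d2 h(sigma t) + d3 (D h)(t) + d4 h(a) + d5 h(b),
all partials being taken along yt.  On the orbits the Euler-Lagrange equation
replaces d2 by D d3, and the product rule for D ([hahnM]) turns the first two
summands into D (d3 h).  The terms of the integral of a Hahn derivative telescope
([is_qwint0_hahn]), so the linear part integrates to
  d3(b) h(b) - d3(a) h(a) + h(a) (integral of d4) + h(b) (integral of d5),
which is 0 by the boundary conditions ([first_variation_eq0]).  What remains is
the integral of the nonnegative function [excess], or of a nonpositive one in
the concave case.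

The integral from a to b of a nonnegative function is nonnegative only when all
orbit points carry nonnegative weights ([is_qwint_ge0]).  If c lies between a and
b, both one-sided integrals have the right sign.  If one endpoint lies on the
orbit of the other, the tails of the two series cancel and a finite sum of
nonnegative terms is left. *)

(** * Orbits of the Hahn shift *)

Section QOmegaIntegral.
Context {R : realType} (q w : R).
Hypotheses (q_gt0 : 0 < q) (q_lt1 : q < 1).
Implicit Types (I : set R) (a b t x v : R) (f g : R -> R) (k n : nat).

Let c := omega0 q w.

Let onemq_neq0 : 1 - q != 0.
Proof. by rewrite subr_eq0 eq_sym lt_eqF. Qed.

Let onemq_gt0 : 0 < 1 - q.
Proof. by rewrite subr_gt0. Qed.

Let omega0E : w = c * (1 - q).
Proof. by rewrite /c /omega0 divfK. Qed.

(** The k-th iterate of x under t |-> q t + w, written in the coordinate centred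
at the fixed point, where the map is multiplication by q. *)
Definition qpoint x k : R := omega0 q w + q ^+ k * (x - omega0 q w).

Lemma qpoint0 x : qpoint x 0 = x.
Proof. by rewrite /qpoint expr0 mul1r addrC subrK. Qed.

Lemma qpointS x k : q * qpoint x k + w = qpoint x k.+1.
Proof. rewrite /qpoint -/c [in X in _ + X = _]omega0E exprS; ring. Qed.

Lemma qpointD x m k : qpoint (qpoint x m) k = qpoint x (m + k).
Proof. rewrite /qpoint exprD; ring. Qed.

Lemma qpointE x k : q ^+ k * x + w * qnum q k = qpoint x k.
Proof.
rewrite /qpoint /omega0 /qnum; field.
exact: onemq_neq0.
Qed.

Lemma qworbitP x t : qworbit q w x t <-> exists k, t = qpoint x k.
Proof. by split=> -[k ->]; exists k; rewrite qpointE. Qed.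

Lemma qpoint_neq x k : x != omega0 q w -> qpoint x k != omega0 q w.
Proof.
move=> xc; rewrite /qpoint -subr_eq0 addrC addKr mulf_neq0 ?subr_eq0//.
by rewrite expf_neq0// gt_eqF.
Qed.

Lemma qpoint_sub x k : (1 - q ^+ k) * (x - omega0 q w) = x - qpoint x k.
Proof. rewrite /qpoint; ring. Qed.

Lemma qpoint_in I x k :
  is_interval I -> I (omega0 q w) -> I x -> I (qpoint x k).
Proof.
move=> Iitv Ic Ix.
have q0 : 0 <= q ^+ k by rewrite exprn_ge0// ltW.
have q1 : 0 <= 1 - q ^+ k by rewrite subr_ge0 exprn_ile1// ltW.
case: (leP x (omega0 q w)) => xc.
- apply: (Iitv x (omega0 q w)) => //; apply/andP; split.
  + by rewrite -subr_le0 -qpoint_sub mulr_ge0_le0// subr_le0.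
  + by rewrite /qpoint gerDl mulr_ge0_le0// subr_le0.
- apply: (Iitv (omega0 q w) x) => //; apply/andP; split.
  + by rewrite /qpoint lerDl mulr_ge0// subr_ge0 ltW.
  + by rewrite -subr_ge0 -qpoint_sub mulr_ge0// subr_ge0 ltW.
Qed.

Lemma qpoint_cvg x : qpoint x k @[k --> \oo] --> omega0 q w.
Proof.
rewrite -[X in _ --> X]addr0; apply: cvgD; first exact: cvg_cst.
rewrite -[X in _ --> X](mul0r (x - omega0 q w)); apply: cvgMl.
by apply: cvg_expr; rewrite gtr0_norm.
Qed.

Lemma cont_on_qpoint I f x :
    is_interval I -> I (omega0 q w) -> I x -> cont_on I f (omega0 q w) ->
  f (qpoint x k) @[k --> \oo] --> f (omega0 q w).
Proof.
move=> Iitv Ic Ix fc; apply: (cvg_comp _ _ _ fc).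
move=> A /(qpoint_cvg x) [N _ NA]; exists N => // k /= Nk.
by apply: NA => //; exact: qpoint_in.
Qed.

(** * The integral from the fixed point *)

Definition qwterm f x k : R :=
  (1 - q) * (x - omega0 q w) * q ^+ k * f (qpoint x k).

(** Integrals are handled through a relation rather than through [qwint0], so that
convergence need not be carried along separately.  The factor x - c is kept inside
the series: at x = c the terms then vanish whatever the integrand, and most facts
below need no separate treatment of that case. *)
Definition is_qwint0 f x v : Prop := series (qwterm f x) @ \oo --> v.

Lemma is_qwint0_unique f x v : is_qwint0 f x v -> qwint0 q w f x = v.
Proof.
move=> fxv.
have wE : x * (1 - q) - w = (1 - q) * (x - c).
  by rewrite [in LHS]omega0E; ring.
rewrite /qwint0 wE.
under [X in series X]funext => k.
  rewrite [x * _]mulrC qpointE; over.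
have [xc|xc] := eqVneq x c.
  have E : series (qwterm f x) = (fun=> 0).
    apply/funext => n; rewrite /series/= big1// => k _.
    by rewrite /qwterm xc subrr mulr0 !mul0r.
  move: fxv; rewrite /is_qwint0 E => fxv.
  rewrite xc subrr mulr0 mul0r.
  exact: (cvg_unique _ (cvg_cst 0) fxv).
have d0 : (1 - q) * (x - c) != 0 by rewrite mulf_neq0// subr_eq0.
suff -> : limn (series (fun k => q ^+ k * f (qpoint x k)))
    = ((1 - q) * (x - c))^-1 * v by rewrite mulrA divff ?mul1r.
apply/cvg_lim => //.
have -> : series (fun k => q ^+ k * f (qpoint x k))
    = (fun n => ((1 - q) * (x - c))^-1 * series (qwterm f x) n).
  apply/funext => n; rewrite /series/= mulr_sumr; apply: eq_bigr => k _.
  by rewrite /qwterm -[_ * q ^+ k * _]mulrA mulKf.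
exact: cvgMr.
Qed.

Lemma eq_is_qwint0 {f} g {x v} :
    (x != omega0 q w -> forall k, f (qpoint x k) = g (qpoint x k)) ->
  is_qwint0 f x v -> is_qwint0 g x v.
Proof.
move=> fg; suff -> : is_qwint0 f x v = is_qwint0 g x v by [].
congr (series _ @ \oo --> v); apply/funext => k; rewrite /qwterm.
have [->|xc] := eqVneq x (omega0 q w); first by rewrite subrr mulr0 !mul0r.
by rewrite fg.
Qed.

Lemma is_qwint0D f g x u v : is_qwint0 f x u -> is_qwint0 g x v ->
  is_qwint0 (fun t => f t + g t) x (u + v).
Proof.
move=> fu gv; rewrite /is_qwint0.
have -> : qwterm (fun t => f t + g t) x = qwterm f x + qwterm g x.
  by apply/funext => k; rewrite /qwterm mulrDr.
by rewrite seriesD; exact: cvgD.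
Qed.

Lemma is_qwint0Z f x u v :
  is_qwint0 f x u -> is_qwint0 (fun t => f t * v) x (u * v).
Proof.
move=> fu; rewrite /is_qwint0.
have -> : series (qwterm (fun t => f t * v) x)
    = (fun n => series (qwterm f x) n * v).
  apply/funext => n; rewrite /series/= mulr_suml; apply: eq_bigr => k _.
  by rewrite /qwterm mulrA.
exact: cvgMl.
Qed.

(** Along an orbit a function continuous at the fixed point is convergent, hence
bounded, and the series is dominated by a geometric one. *)
Lemma cont_on_is_qwint0 I f x :
    is_interval I -> I (omega0 q w) -> I x -> cont_on I f (omega0 q w) ->
  is_qwint0 f x (qwint0 q w f x).
Proof.
move=> Iitv Ic Ix fc; suff /cvg_ex[v fv] : cvgn (series (qwterm f x)).
  by rewrite (is_qwint0_unique _ _ _ fv).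
have /cvgP/cvg_seq_bounded/pinfty_ex_gt0[M M0 fM] :=
  cont_on_qpoint _ _ _ Iitv Ic Ix fc.
apply: normed_cvg.
apply: (@series_le_cvg _ _ (geometric (`|(1 - q) * (x - c)| * M) q)).
- by move=> k; exact: normr_ge0.
- by move=> k /=; rewrite !mulr_ge0 ?exprn_ge0// ltW.
- move=> k /=; rewrite /qwterm !normrM normrX (gtr0_norm q_gt0).
  rewrite [leRHS]mulrAC ler_wpM2l ?mulr_ge0 ?exprn_ge0 ?normr_ge0 ?(ltW q_gt0)//.
  exact: fM.
- by apply: is_cvg_geometric_series; rewrite gtr0_norm.
Qed.

(** * Hahn derivatives and their integrals *)

(** Away from the fixed point the Hahn derivative is a difference quotient and its
rules are identities of fractions; at the fixed point they would be rules for the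
ordinary derivative, which the integrals never see. *)
Lemma hahnE I f t : t != omega0 q w ->
  hahn I q w f t = (f (q * t + w) - f t) / ((q - 1) * (t - omega0 q w)).
Proof.
move=> /negbTE tc; rewrite /hahn tc; congr (_ / _).
by rewrite -/c [in LHS]omega0E; ring.
Qed.

Lemma hahnM I f g t : t != omega0 q w ->
  hahn I q w (fun t => f t * g t) t
    = hahn I q w f t * g (q * t + w) + f t * hahn I q w g t.
Proof. by move=> tc; rewrite !hahnE//; ring. Qed.

Lemma hahnB I f g t : t != omega0 q w ->
  hahn I q w (fun t => f t - g t) t = hahn I q w f t - hahn I q w g t.
Proof. by move=> tc; rewrite !hahnE//; ring. Qed.

(** The weight of the k-th term is the opposite of the denominator of the Hahn
quotient at the k-th orbit point, so the series telescopes. *)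
Lemma is_qwint0_hahn I f x :
    is_interval I -> I (omega0 q w) -> I x -> cont_on I f (omega0 q w) ->
  is_qwint0 (hahn I q w f) x (f x - f (omega0 q w)).
Proof.
move=> Iitv Ic Ix fc; rewrite /is_qwint0.
have -> : series (qwterm (hahn I q w f) x)
    = (fun n => f x - f (qpoint x n)).
  apply/funext => n; rewrite /series/=.
  under eq_bigr => k _.
    have -> : qwterm (hahn I q w f) x k
        = - f (qpoint x k.+1) - - f (qpoint x k).
      have [xc|xc] := eqVneq x (omega0 q w).
        rewrite /qwterm /qpoint xc subrr !mulr0 !addr0 !mul0r; ring.
      rewrite /qwterm hahnE ?qpoint_neq// qpointS /qpoint.
      field.
      by rewrite !subr_eq0 -/(qpoint x k) qpoint_neq//= lt_eqF.
    over.
  by rewrite telescope_sumr// qpoint0 opprK addrC.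
by apply: cvgB; [exact: cvg_cst | exact: cont_on_qpoint Ix fc].
Qed.

(** * Sign of the integral *)

(** The orbit of an orbit point is a tail of the orbit, and the weights agree
because (x - c) q^(n + k) = (sigma^n x - c) q^k. *)
Lemma is_qwint0_qpoint f x v n : is_qwint0 f x v ->
  is_qwint0 f (qpoint x n) (v - \sum_(0 <= k < n) qwterm f x k).
Proof.
move=> fv; rewrite /is_qwint0.
have -> : series (qwterm f (qpoint x n))
    = (fun m => series (qwterm f x) (m + n)%N - \sum_(0 <= k < n) qwterm f x k).
  apply/funext => m; rewrite series_addn [series _ n]/series/= addrC addKr.
  rewrite /series/= -{2}[n]add0n big_addn addnK; apply: eq_bigr => k _.
  rewrite /qwterm qpointD addnC {1}/qpoint exprD; ring.
by apply: cvgB; [rewrite (cvg_shiftn n) | exact: cvg_cst].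
Qed.

Lemma mulr_qwterm_ge0 f x k :
  0 <= f (qpoint x k) -> 0 <= (x - omega0 q w) * qwterm f x k.
Proof.
move=> f0.
have -> : (x - omega0 q w) * qwterm f x k
    = (1 - q) * (x - omega0 q w) ^+ 2 * q ^+ k * f (qpoint x k).
  by rewrite /qwterm; ring.
apply: mulr_ge0 f0; apply: mulr_ge0; last exact/exprn_ge0/ltW.
exact: mulr_ge0 (ltW onemq_gt0) (sqr_ge0 _).
Qed.

Lemma is_qwint0_pos I f x v :
    is_interval I -> I (omega0 q w) -> I x -> (forall t, I t -> 0 <= f t) ->
    is_qwint0 f x v ->
  0 <= (x - omega0 q w) * v.
Proof.
move=> Iitv Ic Ix f0 fv.
have : (fun n => (x - omega0 q w) * series (qwterm f x) n) @ \oo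
    --> (x - omega0 q w) * v by exact: cvgMr.
move=> /(@cvg_lim _ _ _ _ _ _ _) <-//.
apply: limr_ge; first by apply: is_cvgMr; apply/cvg_ex; exists v.
near=> n; rewrite /series/= mulr_sumr sumr_ge0// => k _.
by apply/mulr_qwterm_ge0/f0; exact: qpoint_in.
Unshelve. all: by end_near.
Qed.

(** * Integrals between two points *)

Definition is_qwint a b f v : Prop := exists va vb,
  [/\ is_qwint0 f a va, is_qwint0 f b vb & v = vb - va].

Lemma cont_on_is_qwint I a b f :
    is_interval I -> I (omega0 q w) -> I a -> I b ->
    cont_on I f (omega0 q w) ->
  is_qwint a b f (qwint q w a b f).
Proof.
move=> Iitv Ic Ia Ib fc.
by exists (qwint0 q w f a), (qwint0 q w f b); split => //;
  apply: (cont_on_is_qwint0 I).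
Qed.

Lemma is_qwintD a b f g u v : is_qwint a b f u -> is_qwint a b g v ->
  is_qwint a b (fun t => f t + g t) (u + v).
Proof.
move=> [fa [fb [? ? ->]]] [ga [gb [? ? ->]]].
exists (fa + ga), (fb + gb); split; [exact: is_qwint0D..|ring].
Qed.

Lemma is_qwintZ a b f u v :
  is_qwint a b f u -> is_qwint a b (fun t => f t * v) (u * v).
Proof.
move=> [fa [fb [? ? ->]]]; exists (fa * v), (fb * v).
by split; [exact: is_qwint0Z..|rewrite mulrBl].
Qed.

Lemma is_qwintB a b f g u v : is_qwint a b f u -> is_qwint a b g v ->
  is_qwint a b (fun t => f t - g t) (u - v).
Proof.
move=> fu /(is_qwintZ _ _ _ _ (-1)) gv.
have := is_qwintD _ _ _ _ _ _ fu gv.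
by rewrite mulrN1; under eq_fun do rewrite mulrN1.
Qed.

Lemma is_qwint_hahn I a b f :
    is_interval I -> I (omega0 q w) -> I a -> I b ->
    cont_on I f (omega0 q w) ->
  is_qwint a b (hahn I q w f) (f b - f a).
Proof.
move=> Iitv Ic Ia Ib fc.
exists (f a - f (omega0 q w)), (f b - f (omega0 q w)).
by split; [exact: is_qwint0_hahn..|ring].
Qed.

Lemma eq_is_qwint {a b f} g {v} :
    (forall t, qworbit q w a t \/ qworbit q w b t -> t != omega0 q w ->
      f t = g t) ->
  is_qwint a b f v -> is_qwint a b g v.
Proof.
move=> fg [va [vb [fa fb ->]]]; exists va, vb; split => //.
- apply: eq_is_qwint0 fa => ac k; apply: fg (qpoint_neq _ _ ac).
  by left; apply/qworbitP; exists k.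
- apply: eq_is_qwint0 fb => bc k; apply: fg (qpoint_neq _ _ bc).
  by right; apply/qworbitP; exists k.
Qed.

(** The two series share a tail, so their difference is a finite sum. *)
Let is_qwint0_subr_pos I f x n u v :
    is_interval I -> I (omega0 q w) -> I x -> (forall t, I t -> 0 <= f t) ->
    is_qwint0 f x u -> is_qwint0 f (qpoint x n) v ->
  0 <= (x - omega0 q w) * (u - v).
Proof.
move=> Iitv Ic Ix f0 fu.
move/is_qwint0_unique.
rewrite (is_qwint0_unique _ _ _ (is_qwint0_qpoint _ _ _ n fu)).
move=> <-; rewrite subKr mulr_sumr sumr_ge0// => k _.
by apply/mulr_qwterm_ge0/f0; exact: qpoint_in.
Qed.

(** Iterates move towards the fixed point, so the direction of the move tells on
which side of it x lies. *)
Let qpoint_lt_side x n : qpoint x n < x -> omega0 q w < x.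
Proof.
have q1 : 0 <= 1 - q ^+ n by rewrite subr_ge0 exprn_ile1// ltW.
rewrite -subr_gt0 -qpoint_sub => xn_gt0; rewrite ltNge; apply/negP => xc.
by move: xn_gt0; apply/negP; rewrite -leNgt mulr_ge0_le0// subr_le0.
Qed.

Let qpoint_gt_side x n : x < qpoint x n -> x < omega0 q w.
Proof.
have q1 : 0 <= 1 - q ^+ n by rewrite subr_ge0 exprn_ile1// ltW.
rewrite -subr_lt0 -qpoint_sub => xn_lt0; rewrite ltNge; apply/negP => xc.
by move: xn_lt0; apply/negP; rewrite -leNgt mulr_ge0// subr_ge0.
Qed.

(** When a and b lie on the same side of the fixed point, the orbit of the closer
endpoint enters with negative weights; these are compensated only if that orbit is
part of the other one, whence the condition on the position of a and b. *)
Lemma is_qwint_ge0 I a b f v :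
    is_interval I -> I (omega0 q w) -> I a -> I b -> a < b ->
    a <= omega0 q w <= b \/ qworbit q w b a \/ qworbit q w a b ->
    (forall t, I t -> 0 <= f t) -> is_qwint a b f v ->
  0 <= v.
Proof.
move=> Iitv Ic Ia Ib ab pos f0 [va [vb [fa fb ->]]].
case: pos => [/andP[ac cb]|[|]].
- have va0 : va <= 0.
    have [aE|a_neq] := eqVneq a (omega0 q w).
      move: fa => /is_qwint0_unique <-.
      by rewrite /qwint0 aE {1}/omega0 divfK// subrr mul0r.
    have := is_qwint0_pos _ _ _ _ Iitv Ic Ia f0 fa.
    by rewrite nmulr_rge0// subr_lt0 lt_neqAle a_neq.
  have vb0 : 0 <= vb.
    have [bE|b_neq] := eqVneq b (omega0 q w).
      move: fb => /is_qwint0_unique <-.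
      by rewrite /qwint0 bE {1}/omega0 divfK// subrr mul0r.
    have := is_qwint0_pos _ _ _ _ Iitv Ic Ib f0 fb.
    by rewrite pmulr_rge0// subr_gt0 lt_neqAle eq_sym b_neq.
  by rewrite subr_ge0 (le_trans va0).
- move=> /qworbitP[n an]; move: ab fa; rewrite an => /qpoint_lt_side cb fa.
  have := is_qwint0_subr_pos _ _ _ _ _ _ Iitv Ic Ib f0 fb fa.
  by rewrite pmulr_rge0// subr_gt0.
- move=> /qworbitP[n bn]; move: ab fb; rewrite bn => /qpoint_gt_side ac fb.
  have := is_qwint0_subr_pos _ _ _ _ _ _ Iitv Ic Ia f0 fa fb.
  by rewrite nmulr_rge0 ?subr_lt0// subr_le0 subr_ge0.
Qed.

(** * Vanishing of the first variation *)

(** The integrand agrees on the orbits with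
D (p3 h) + p4 h(a) + p5 h(b), whose integral is computed by telescoping; the
boundary terms of p3 h then cancel the other two integrals. *)
Lemma first_variation_eq0 I a b (p2 p3 p4 p5 h dh : R -> R) :
    is_interval I -> I (omega0 q w) -> I a -> I b ->
    cont_on I p3 (omega0 q w) -> cont_on I p4 (omega0 q w) ->
    cont_on I p5 (omega0 q w) -> cont_on I h (omega0 q w) ->
    (forall t, qworbit q w a t \/ qworbit q w b t ->
      p2 t = hahn I q w p3 t) ->
    p3 a = qwint q w a b p4 -> p3 b = - qwint q w a b p5 ->
    (forall t, t != omega0 q w -> dh t = hahn I q w h t) ->
  is_qwint a b
    (fun t => p2 t * h (q * t + w) + p3 t * dh t + p4 t * h a + p5 t * h b) 0.
Proof.
move=> Iitv Ic Ia Ib p3c p4c p5c hc EL BCa BCb dhE.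
have p3hc : cont_on I (fun t => p3 t * h t) (omega0 q w) by exact: cvgM.
have int3 := is_qwint_hahn _ _ _ _ Iitv Ic Ia Ib p3hc.
have int4 := is_qwintZ _ _ _ _ (h a) (cont_on_is_qwint _ _ _ _ Iitv Ic Ia Ib p4c).
have int5 := is_qwintZ _ _ _ _ (h b) (cont_on_is_qwint _ _ _ _ Iitv Ic Ia Ib p5c).
have := is_qwintD _ _ _ _ _ _ (is_qwintD _ _ _ _ _ _ int3 int4) int5.
rewrite -BCa -[qwint q w a b p5]opprK -BCb.
rewrite (_ : _ + _ = 0); last by ring.
by apply: eq_is_qwint => t orb tc; rewrite hahnM// EL// dhE.
Qed.

End QOmegaIntegral.

(** * The linear part of the increment of the functional *)

Section Variation.
Context {R : realType} (q w : R) (I : set R) (a b : R)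
  (L : R -> 'rV[R]_4 -> R) (yt y : R -> R).
Hypotheses (q_gt0 : 0 < q) (q_lt1 : q < 1).
Hypotheses (I_interval : is_interval I) (I_omega0 : I (omega0 q w)).
Hypotheses (I_a : I a) (I_b : I b).

Definition args (z : R -> R) t : 'rV[R]_4 :=
  \row_(j < 4) tnth [tuple z (q * t + w); hahn I q w z t; z a; z b] j.

Lemma args0 z t : args z t 0 (inord 0%N) = z (q * t + w).
Proof. by rewrite mxE (tnth_nth 0) inordK. Qed.

Lemma args1 z t : args z t 0 (inord 1%N) = hahn I q w z t.
Proof. by rewrite mxE (tnth_nth 0) inordK. Qed.

Lemma args2 z t : args z t 0 (inord 2%N) = z a.
Proof. by rewrite mxE (tnth_nth 0) inordK. Qed.

Lemma args3 z t : args z t 0 (inord 3%N) = z b.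
Proof. by rewrite mxE (tnth_nth 0) inordK. Qed.

Definition lin_incr t : R :=
  \sum_(j < 4) partial L j t (args yt t) * (args y t - args yt t) 0 j.

Lemma lin_incrE t :
  let d j := partial L (inord j) t (args yt t)
    * (args y t 0 (inord j) - args yt t 0 (inord j)) in
  lin_incr t = d 0%N + d 1%N + d 2%N + d 3%N.
Proof.
move=> d.
have -> : lin_incr t = \sum_(j < 4) d (nat_of_ord j).
  apply: eq_bigr => j _; rewrite /d inord_val; congr (_ * _).
  by rewrite mxE [in X in _ + X]mxE.
by rewrite !big_ord_recl big_ord0 addr0 !addrA.
Qed.

(** The amount by which the increment of the integrand exceeds its linearization:
its sign is exactly what convexity or concavity provides. *)
Definition excess t : R :=
  bracket I q w a b L y t - bracket I q w a b L yt t - lin_incr t.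

(** The linear part integrates to zero, hence the excess accounts for the whole
increment of the functional. *)
Lemma is_qwint_excess :
    (forall z, calY I q w a b 1 z ->
      cont_on I (bracket I q w a b L z) (omega0 q w)) ->
    (forall j : 'I_4,
      calY I q w a b 1 (bracket I q w a b (partial L j) yt)) ->
    calY I q w a b 1 yt -> calY I q w a b 1 y ->
    euler_lagrange I q w a b L yt -> boundary_conditions I q w a b L yt ->
  is_qwint q w a b excess
    (functional I q w a b L y - functional I q w a b L yt).
Proof.
move=> contL contp Yyt Yy EL [BCa BCb].
have cont0 z : calY I q w a b 1 z -> cont_on I z (omega0 q w).
  by move=> [_ /(_ 0%N isT)[]].
rewrite -[X in is_qwint _ _ _ _ _ X]subr0.
apply: (is_qwintB q w); last first.
  pose h t := y t - yt t.
  pose p j := bracket I q w a b (partial L (inord j)) yt.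
  have pc j : cont_on I (p j) (omega0 q w) by exact/cont0/contp.
  have hc : cont_on I h (omega0 q w) by apply: cvgB; exact: cont0.
  have ELp t : qworbit q w a t \/ qworbit q w b t ->
      p 0%N t = hahn I q w (p 1%N) t.
    by move=> orb; apply/eqP; rewrite -subr_eq0; apply/eqP/EL; left.
  have dhE t : t != omega0 q w ->
      hahn I q w y t - hahn I q w yt t = hahn I q w h t.
    by move=> tc; rewrite hahnB.
  have := first_variation_eq0 q w q_gt0 q_lt1 I a b _ _ _ _ _ _ I_interval
    I_omega0 I_a I_b (pc 1%N) (pc 2%N) (pc 3%N) hc ELp BCa BCb dhE.
  congr (is_qwint _ _ _ _ _ _); apply/funext => t.
  rewrite lin_incrE /p /h /bracket.
  by rewrite !args0 !args1 !args2 !args3.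
by apply: (is_qwintB q w); apply: (cont_on_is_qwint q w _ _ I) => //;
  exact: contL.
Qed.

End Variation.

(** * Sufficiency of the Euler-Lagrange equation *)

Theorem theorem3p13 (R : realType) (q w : R) (I : set R) (a b : R)
    (L : R -> 'rV[R]_4 -> R) (yt : R -> R)
    (q_gt0 : 0 < q) (q_lt1 : q < 1) (w_ge0 : 0 <= w)
    (I_interval : is_interval I) (I_omega0 : I (omega0 q w))
    (I_a : I a) (I_b : I b) (ab : a < b)
    (ab_position : a <= omega0 q w <= b \/
       qworbit q w b a \/ qworbit q w a b)
    (H1 : forall t, I t -> C1 (L t))
    (H2 : forall y, calY I q w a b 1 y ->
       cont_on I (bracket I q w a b L y) (omega0 q w))
    (H3 : forall y, calY I q w a b 1 y ->
       forall j : 'I_4, calY I q w a b 1 (bracket I q w a b (partial L j) y))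
    (Y_yt : calY I q w a b 1 yt)
    (EL : euler_lagrange I q w a b L yt)
    (BC : boundary_conditions I q w a b L yt) :
  (jointly_convex I L -> global_minimizer I q w a b L yt) /\
  (jointly_concave I L -> global_maximizer I q w a b L yt).
Proof.
have main y : calY I q w a b 1 y -> is_qwint q w a b
    (excess q w I a b L yt y)
    (functional I q w a b L y - functional I q w a b L yt).
  by move=> Yy; apply: is_qwint_excess => //; exact: H3.
split=> -[_ Lconv] y /main int.
- rewrite -subr_ge0.
  apply: (is_qwint_ge0 q w _ _ I a b _ _ _ _ _ _ _ _ _ int) => // t It.
  have := Lconv t (args q w I a b yt t)
    (args q w I a b y t - args q w I a b yt t) It.
  by rewrite subrKC /excess subr_ge0.
- rewrite -subr_ge0 -opprB -mulrN1.
  (* For a concave Lagrangian it is the opposite of the excess that is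
     nonnegative. *)
  apply: (is_qwint_ge0 q w _ _ I a b _ _ _ _ _ _ _ _ _
    (is_qwintZ q w _ _ _ _ (-1) int)) => // t It.
  have := Lconv t (args q w I a b yt t)
    (args q w I a b y t - args q w I a b yt t) It.
  by rewrite subrKC mulrN1 /excess oppr_ge0 subr_le0.
Qed.
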